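(* Let $(\mathcal S,\mathcal A,P,R,\gamma)$ be a finite discounted MDP (cost-minimization convention), let $h$ be a convex function as in the context, and let $\{\pi^{(k)}\}_{k\ge0}\subset\Pi$ be a sequence generated by policy mirror descent with $\pi^{(0)}\in\Pi$ and constant step size $\eta_k=\eta>0$ for all $k\ge 0$, i.e. $$\pi_s^{(k+1)} \in \mathop{\arg\min}_{p \in \Delta(\mathcal A)} \left\{ \eta \langle Q_s(\pi^{(k)}), p\rangle + D(p, \pi_s^{(k)}) \right\},\qquad \forall s\in\mathcal S,\ k\ge 0.$$ Suppose that $$Q_{s,a}(\pi^{(k)}) - Q^*_{s,a} \le A_k,\qquad \forall s\in\mathcal S,\ a\in\mathcal A,\ k\ge 0,$$ where $\{A_k\}_{k\ge0}$ is a decreasing sequence of real numbers with $\lim_{k\to+\infty}A_k=0$. Assume that $h$ is continuously differentiable on $\Delta(\mathcal A)$ and $L$-cocoercive on $\Delta(\mathcal A)$ under a norm $\|\cdot\|$ on $\mathbb R^{|\mathcal A|}$, for some $L>0$: $$\langle\nabla h(p)-\nabla h(q),\,p-q\rangle\ \ge\ \frac1L\,\|\nabla h(p)-\nabla h(q)\|^2,\qquad\forall p,q\in\Delta(\mathcal A).$$ Then policy mirror descent with the Bregman divergence defined by $h$ can stop after finitely many iterations: there exists a finite $K$ such that for all $k\ge K$ and all $s\in\mathcal S$, $\pi_s^{(k+1)}\in\Pi_s^*$ and $V_s(\pi^{(k+1)})=V_s^*$.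
   Context: MDP. $\mathcal S,\mathcal A$ are finite state and action spaces; $P(s'|s,a)$ is the probability of moving to $s'$ after taking action $a$ in state $s$; $R_{s,a}\in[0,1]$; $\gamma\in[0,1)$. $\Delta(\mathcal A)=\{p\in\mathbb R^{|\mathcal A|}:\sum_a p_a=1,\ p_a\ge 0\}$ is the probability simplex, and the policy set is $\Pi=\Delta(\mathcal A)^{|\mathcal S|}$, $\pi=\{\pi_s\}_{s\in\mathcal S}$ with $\pi_{s,a}$ the probability of action $a$ in state $s$. Let $P_{s,s'}(\pi)=\sum_a\pi_{s,a}P(s'|s,a)$, $r_s(\pi)=\sum_a R_{s,a}\pi_{s,a}$, $V(\pi)=(I-\gamma P(\pi))^{-1}r(\pi)\in\mathbb R^{|\mathcal S|}$, $Q_{s,a}(\pi)=R_{s,a}+\gamma\sum_{s'}P(s'|s,a)V_{s'}(\pi)$, and $Q_s(\pi)=(Q_{s,a}(\pi))_{a\in\mathcal A}$. Optimality is in the sense of minimization: $V^*$ is the optimal value function, $V^*_s=\min_{\pi\in\Pi}V_s(\pi)$ for all $s$ (attained simultaneously in all states by some policy), and $Q^*_{s,a}=R_{s,a}+\gamma\sum_{s'}P(s'|s,a)V^*_{s'}$. $\Pi^*=\{\pi\in\Pi:V(\pi)=V^*\}$ and $\Pi_s^*=\{\pi_s:\ \pi\in\Pi^*\}$. Mirror map. $h$ is a proper convex function on $\mathbb R^{|\mathcal A|}$ with effective domain $\mathrm{dom}(h)\supseteq\Delta(\mathcal A)$. The Bregman divergence is $D(p,p')=h(p)-h(p')-\langle\nabla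 h(p'),p-p'\rangle$ for $p,p'\in\Delta(\mathcal A)$. *)

(* Defs.v *)
From HB Require Import structures.
From mathcomp Require Import all_boot all_order all_algebra.
From mathcomp Require Import all_classical all_reals all_analysis.
Import Order.TTheory GRing.Theory Num.Theory.
Import numFieldNormedType.Exports.

Set Implicit Arguments.
Unset Strict Implicit.
Unset Printing Implicit Defensive.

Local Open Scope classical_set_scope.
Local Open Scope ring_scope.

Definition dotp (R : realType) (n : nat) (u v : 'rV[R]_n) : R :=
  \sum_(i < n) u 0 i * v 0 i.

Definition simplex (R : realType) (n : nat) : set 'rV[R]_n :=
  [set p | (forall i, 0 <= p 0 i) /\ \sum_(i < n) p 0 i = 1].

Definition argmin (R : realType) (T : Type) (D : set T) (f : T -> R) : set T :=
  [set x | D x /\ forall y, D y -> f x <= f y].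

Definition is_norm (R : realType) (n : nat) (N : 'rV[R]_n -> R) : Prop :=
  [/\ forall u, 0 <= N u,
      forall u, N u = 0 -> u = 0,
      forall (c : R) u, N (c *: u) = `|c| * N u &
      forall u v, N (u + v) <= N u + N v].

(* States and actions are enumerated by 'I_S and 'I_A; [trans s a s'] is
   P(s'|s,a) and costs are to be minimized. *)
Record mdp (R : realType) (S A : nat) := Mdp {
  trans : 'I_S -> 'I_A -> 'I_S -> R ;
  cost : 'M[R]_(S, A) ;
  discount : R ;
  trans_ge0 : forall s a s', 0 <= trans s a s' ;
  trans_sum1 : forall s a, \sum_(s' < S) trans s a s' = 1 ;
  cost_itv : forall s a, 0 <= cost s a <= 1 ;
  discount_itv : 0 <= discount < 1 }.

Section MdpTheory.
Variables (R : realType) (S A : nat) (M : mdp R S A).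

Definition policies : set 'M[R]_(S, A) :=
  [set pi | forall s, simplex (row s pi)].

Definition trans_pi (pi : 'M[R]_(S, A)) : 'M[R]_S :=
  \matrix_(s, s') \sum_(a < A) pi s a * trans M s a s'.

Definition cost_pi (pi : 'M[R]_(S, A)) : 'cV[R]_S :=
  \col_s \sum_(a < A) cost M s a * pi s a.

(* The matrix I - gamma P(pi) is invertible for every policy pi, so that
   [invmx] is a genuine inverse there. *)
Definition value (pi : 'M[R]_(S, A)) : 'cV[R]_S :=
  invmx (1%:M - discount M *: trans_pi pi) *m cost_pi pi.

Definition qvalue_of (v : 'cV[R]_S) : 'M[R]_(S, A) :=
  \matrix_(s, a) (cost M s a + discount M * \sum_(s' < S) trans M s a s' * v s' 0).

Definition qvalue (pi : 'M[R]_(S, A)) : 'M[R]_(S, A) := qvalue_of (value pi).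

(* The minimum over all policies exists, hence coincides with this infimum. *)
Definition opt_value : 'cV[R]_S :=
  \col_s inf [set value pi s 0 | pi in policies].

Definition opt_qvalue : 'M[R]_(S, A) := qvalue_of opt_value.

Definition opt_policies : set 'M[R]_(S, A) :=
  [set pi | policies pi /\ value pi = opt_value].

Definition opt_policies_at (s : 'I_S) : set 'rV[R]_A :=
  [set row s pi | pi in opt_policies].

End MdpTheory.

Section MirrorMap.
Variables (R : realType) (n : nat).
Implicit Types (h : 'rV[R]_n -> \bar R) (p q g : 'rV[R]_n).

Definition edom h : set 'rV[R]_n := [set p | (h p < +oo)%E].

Definition proper_efun h : Prop := (forall p, h p != -oo%E) /\ edom h !=set0.

Definition convex_efun h : Prop :=
  forall p q (t : R), 0 < t < 1 ->
    (h (t *: p + (1 - t) *: q)%R <= t%:E * h p + (1 - t)%:E * h q)%E.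

(* [g] is a gradient of [h] at [p] relative to the effective domain of [h]. At
   interior points of the domain this is Frechet differentiability with
   gradient [g], see [has_gradientP]. At boundary points, where a convex
   extended-valued function is never differentiable in the ambient space, it is
   the usual one-sided notion (e.g. for Tsallis entropies on the nonnegative
   orthant). If the domain lies in a proper affine subspace, [g] is determined
   only up to a normal vector, hence the explicit gradient map [dh] below. *)
Definition has_gradient h p g : Prop :=
  (fun q => fine (h q) - fine (h p) - dotp g (q - p) : R^o)
    =o_ (within (edom h) (nbhs p)) (fun q => q - p).

Lemma within_interior (D : set 'rV[R]_n) p : D° p -> within D (nbhs p) = nbhs p.
Proof.
move=> Dp; apply/seteqP; split=> A HA; last first.
  by apply: (@cvg_within _ (nbhs p) _ D).
have {}HA : \forall x \near p, D x -> A x := HA.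
near=> x.
by apply: (near HA x) => //; near: x; exact: Dp.
Unshelve. all: by end_near. Qed.

Lemma dotp_is_linear g : linear (dotp g : 'rV[R]_n -> R^o).
Proof.
move=> c u v; rewrite /dotp scaler_sumr -big_split/=; apply: eq_bigr => i _.
by rewrite !mxE mulrDr mulrCA.
Qed.

Lemma dotp_continuous g : continuous (dotp g : 'rV[R]_n -> R^o).
Proof.
rewrite /dotp; elim: (index_enum _) => [|i s IH].
  rewrite (_ : (fun v : 'rV[R]_n => _) = cst 0); first exact: cst_continuous.
  by apply/funext => v; rewrite big_nil.
rewrite (_ : (fun v : 'rV[R]_n => _) =
    (fun v => g 0 i * v 0 i + \sum_(j <- s) g 0 j * v 0 j)); last first.
  by apply/funext => v; rewrite big_cons.
move=> p; apply: (@cvgD R R^o _ (nbhs p)); last exact: IH.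
exact: cvgMl_tmp (@coord_continuous R 1 n 0 i p).
Qed.

Lemma differentiable_littleoP (V W : normedModType R) (f : V -> W)
    (df : {linear V -> W}) (x : V) : continuous df ->
  (fun y => f y - f x - df (y - x)) =o_ (nbhs x) (fun y => y - x) <->
  differentiable f x /\ 'd f x = df :> (V -> W).
Proof.
move=> dfc; split=> [/eqoP H|[dfx dE]].
  have {}H : f \o shift x = cst (f x) + df +o_ 0 id.
    apply/eqaddoP => e e0; have := H e e0.
    rewrite [\forall y \near _, _ <= _](near_shift 0) subr0; apply: filterS => v.
    by rewrite /= addrK !fctE/= opprD addrA.
  have dE : 'd f x = df :> (V -> W) by exact: diff_unique.
  by split=> //; apply/diff_locallyP; rewrite dE.
have /diff_locallyP[_] := dfx; rewrite dE => /eqaddoP H.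
apply/eqoP => e e0; have := H e e0.
rewrite [\forall v \near _, _ <= _](near_shift x) sub0r; apply: filterS => v.
by rewrite /= !fctE /= subrK opprD addrA.
Qed.

Lemma has_gradientP h p g : (edom h)° p ->
  has_gradient h p g <->
  differentiable (fine \o h : 'rV[R]_n -> R^o) p /\
  'd (fine \o h : 'rV[R]_n -> R^o) p = dotp g :> ('rV[R]_n -> R^o).
Proof.
move=> /within_interior dp.
pose lin := GRing.isLinear.Build _ _ _ _ _ (@dotp_is_linear g).
pose df : {linear 'rV[R]_n -> R^o} := HB.pack (dotp g : 'rV[R]_n -> R^o) lin.
apply: iff_trans (differentiable_littleoP (fine \o h : 'rV[R]_n -> R^o)
  (df := df) p (@dotp_continuous g)).
by split=> /eqoP H; apply/eqoP => e e0; have := H e e0; rewrite /= dp.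
Qed.

Definition continuously_differentiable_on (D : set 'rV[R]_n) h
    (dh : 'rV[R]_n -> 'rV[R]_n) : Prop :=
  (forall p, D p -> has_gradient h p (dh p)) /\ {within D, continuous dh}.

Definition cocoercive_on (D : set 'rV[R]_n) (N : 'rV[R]_n -> R) (L : R)
    (dh : 'rV[R]_n -> 'rV[R]_n) : Prop :=
  forall p q, D p -> D q ->
    L^-1 * N (dh p - dh q) ^+ 2 <= dotp (dh p - dh q) (p - q).

Definition bregman h (dh : 'rV[R]_n -> 'rV[R]_n) p q : R :=
  fine (h p) - fine (h q) - dotp (dh q) (p - q).

End MirrorMap.

Definition policy_mirror_descent (R : realType) (S A : nat) (M : mdp R S A)
    (h : 'rV[R]_A -> \bar R) (dh : 'rV[R]_A -> 'rV[R]_A) (eta : R)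
    (pi : nat -> 'M[R]_(S, A)) : Prop :=
  policies (pi 0%N) /\
  forall k s, argmin (@simplex R A)
    (fun p => eta * dotp (row s (qvalue M (pi k))) p
              + bregman h dh p (row s (pi k)))
    (row s (pi k.+1)).

(* Main.v *)
Require Import Defs.
From mathcomp Require Import all_boot all_order all_algebra.
From mathcomp Require Import all_classical all_reals all_analysis.
From mathcomp Require Import ring lra.
Import Order.TTheory GRing.Theory Num.Theory.
Import numFieldNormedType.Exports.
Local Open Scope classical_set_scope.
Local Open Scope ring_scope.

(** The gradient steps vanish because the values decrease and are bounded below,
    whereas a suboptimal action that still carries mass forces a gradient step
    of a fixed size.

    Write [p] and [p'] for two consecutive iterates in a state [s], and [q] for
    the Q-values of the former. Minimality of [p'] yields the variational
    inequality
    [0 <= dotp (eta *: q + (dh p' - dh p)) (y - p')] for all [y] in the simplex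
    ([mirror_step_variational]), which is used twice.

    With [y := p] it gives
    [dotp (dh p' - dh p) (p' - p) <= eta * (dotp q p - dotp q p')]. The left
    side is nonnegative by cocoercivity, so the step improves the policy. By
    the Bellman equation [dotp q p] is the value [V_s] of the old policy, and
    [dotp q p'] is at least that of the new one ([policy_improvement]). Using
    cocoercivity once more, the squared norm of
    [dh p' - dh p] is at most [L * eta] times the decrease of [V_s]
    ([pmd_gradient_step_le]). As [V_s] decreases along the iteration and is
    nonnegative, it converges, and therefore [dh p' - dh p] tends to [0], in
    every coordinate because all norms on a finite-dimensional space are
    equivalent ([pmd_gradient_step_cvg0]).

    With [y] obtained from [p'] by moving the mass of an action [a] with
    [0 < p' a] to an action [b], it gives
    [eta * (q a - q b) <= (dh p' - dh p) b - (dh p' - dh p) a]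
    ([simplex_active_min]), whose right side tends to [0]. If [a] is suboptimal
    and [b] optimal, then [q a - q b] is eventually at least half of the
    positive gap between their optimal Q-values, because [q] dominates the
    optimal Q-values and exceeds them by at most [Ak k]. So eventually
    [p' a = 0] ([pmd_suboptimal_eventually0]).

    There are finitely many states and actions, so from some index on all
    iterates put mass only on minimizers of the optimal Q-values, and such a
    policy is optimal ([greedy_opt_policies]). *)

(** * The standard pairing and the simplex *)

Section Dotp.
Context {R : realType} {n : nat}.
Implicit Types (u v w g p q : 'rV[R]_n) (c : R).

Lemma dotpC u v : dotp u v = dotp v u.
Proof. by apply: eq_bigr => i _; rewrite mulrC. Qed.

Lemma dotpDr u v w : dotp u (v + w) = dotp u v + dotp u w.
Proof.
by rewrite /dotp -big_split; apply: eq_bigr => i _; rewrite !mxE mulrDr.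
Qed.

Lemma dotpZr c u v : dotp u (c *: v) = c * dotp u v.
Proof. by rewrite /dotp mulr_sumr; apply: eq_bigr => i _; rewrite !mxE mulrCA. Qed.

Lemma dotpBr u v w : dotp u (v - w) = dotp u v - dotp u w.
Proof. by rewrite dotpDr -scaleN1r dotpZr mulN1r. Qed.

Lemma dotpDl u v w : dotp (v + w) u = dotp v u + dotp w u.
Proof. by rewrite dotpC dotpDr !(dotpC u). Qed.

Lemma dotpZl c u v : dotp (c *: v) u = c * dotp v u.
Proof. by rewrite dotpC dotpZr dotpC. Qed.

Lemma dotpBl u v w : dotp (v - w) u = dotp v u - dotp w u.
Proof. by rewrite dotpC dotpBr !(dotpC u). Qed.

Lemma dotp_delta g i : dotp g (delta_mx 0 i) = g 0 i.
Proof.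
rewrite /dotp (bigD1 i)//= mxE !eqxx mulr1 big1 ?addr0// => j ji.
by rewrite mxE (negbTE ji) andbF mulr0.
Qed.

Lemma simplex_segment p q c : simplex p -> simplex q -> 0 <= c <= 1 ->
  simplex (p + c *: (q - p)).
Proof.
move=> [p0 p1] [q0 q1] /andP[c0 c1]; split=> [i|].
  rewrite !mxE; have := p0 i; have := q0 i; nra.
under eq_bigr do rewrite !mxE.
by rewrite big_split/= -mulr_sumr sumrB p1 q1 subrr mulr0 addr0.
Qed.

Lemma simplex_transfer p i j : simplex p ->
  simplex (p + p 0 i *: (delta_mx 0 j - delta_mx 0 i)).
Proof.
move=> [p0 p1]; split=> [l|].
  rewrite !mxE !eqxx/=; have := p0 i; have := p0 l.
  by case: (eqVneq l i) => [->|_]; case: eqP => _ /=; lra.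
have sum_delta (k : 'I_n) : \sum_(l < n) (delta_mx 0 k : 'rV[R]_n) 0 l = 1.
  rewrite (bigD1 k)//= mxE !eqxx big1 ?addr0// => l lk.
  by rewrite mxE (negbTE lk) andbF.
transitivity (\sum_(l < n) (p 0 l +
    p 0 i * ((delta_mx 0 j : 'rV[R]_n) 0 l - (delta_mx 0 i : 'rV[R]_n) 0 l))).
  by apply: eq_bigr => l _; rewrite !mxE.
by rewrite big_split/= -mulr_sumr sumrB !sum_delta subrr mulr0 addr0.
Qed.

(** The first-order condition for a linear cost: moving the mass that [p] puts
    on [i] to any other coordinate is a feasible direction, hence cannot
    decrease the cost. *)
Lemma simplex_active_min g p i : simplex p ->
  (forall q, simplex q -> 0 <= dotp g (q - p)) -> 0 < p 0 i ->
  forall j, g 0 i <= g 0 j.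
Proof.
move=> sp opt pi_gt0 j.
have := opt _ (simplex_transfer p i j sp).
by rewrite addrC addKr dotpZr dotpBr !dotp_delta pmulr_rge0 ?subr_ge0.
Qed.

End Dotp.

(** * Equivalence of an abstract norm with the supremum norm *)

Section NormEquivalence.
Context {R : realType} {n : nat} {N : 'rV[R]_n -> R} (normN : is_norm N).

Let N0 : N 0 = 0.
Proof. by case: normN => _ _ NZ _; rewrite -(scale0r 0) NZ normr0 mul0r. Qed.

Lemma is_norm_ub : exists B, forall u, N u <= B * `|u|.
Proof.
case: normN => [Nge0 _ NZ ND].
exists (\sum_i N (delta_mx 0 i)) => u; rewrite {1}(row_sum_delta u) mulr_suml.
elim/big_ind2 : _ => [|x a y b xa yb|i _]; first by rewrite N0.
  exact: le_trans (ND _ _) (lerD xa yb).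
rewrite NZ mulrC ler_wpM2l//.
rewrite [leRHS]/Num.norm/= mx_normrE; apply/bigmax_geP; right => /=.
by exists (0, i).
Qed.

Lemma is_norm_dist u v : `|N u - N v| <= N (u - v).
Proof.
case: normN => [_ _ NZ ND].
have NN w : N (- w) = N w by rewrite -scaleN1r NZ normrN normr1 mul1r.
rewrite ler_distl; apply/andP; split.
  have := ND (v - u) u; rewrite subrK -(NN (v - u)) opprB; lra.
have := ND (u - v) v; rewrite subrK; lra.
Qed.

Lemma is_norm_continuous : continuous N.
Proof.
have [B NB] := is_norm_ub => u.
have B0 : 0 < `|B| + 1 by rewrite ltr_wpDl.
apply/(@cvgrPdist_le _ R^o _ _ (nbhs_filter u)) => e e0.
near=> v.
have duv : `|u - v| * (`|B| + 1) <= e.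
  rewrite -ler_pdivlMr//.
  near: v; apply/nbhs_ballP; exists (e / (`|B| + 1)); first exact: divr_gt0.
  by move=> v; rewrite -ball_normE => /ltW.
apply: le_trans (is_norm_dist u v) _; apply: le_trans (NB _) _.
apply: le_trans duv; rewrite mulrC ler_wpM2l//.
by rewrite (le_trans (ler_norm B))// lerDl.
Unshelve. all: by end_near. Qed.

(** [N] is continuous for the supremum norm and positive on its compact unit
    sphere, so that it attains a positive minimum there. *)
Lemma is_norm_lb : exists2 C, 0 < C & forall u, `|u| <= C * N u.
Proof.
case: normN => [Nge0 Neq0 NZ ND].
pose sph := [set u : 'rV[R]_n | `|u| = 1].
have normalize (u : 'rV[R]_n) : u != 0 -> sph (`|u|^-1 *: u).
  by move=> u0; rewrite /sph/= normrZ normfV normr_id mulVf// normr_eq0.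
(* In dimension 0 the sphere is empty and there is no minimum to take. *)
have [sph0|] := eqVneq sph set0.
  exists 1 => // u; have [->|/normalize] := eqVneq u 0.
    by rewrite normr0 mul1r.
  by rewrite sph0.
move=> /set0P sph_neq0.
have sph_compact : compact sph.
  apply: bounded_closed_compact.
    by exists 1; split=> // x x1 u /= ->; rewrite ltW.
  have -> : sph = (fun u : 'rV[R]_n => `|u|) @^-1` [set (1 : R)] by [].
  apply: closed_comp; last exact: closed_eq.
  by move=> u _; exact: norm_continuous.
have [c csph cmin] := EVT_min_rV sph_neq0 sph_compact
  (continuous_subspaceT is_norm_continuous).
have Nc0 : 0 < N c.
  rewrite lt_neqAle Nge0 andbT eq_sym; apply/eqP => /Neq0 c0.
  move: csph; rewrite c0 inE /sph/= normr0 => /eqP.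
  by rewrite eq_sym oner_eq0.
exists (N c)^-1; rewrite ?invr_gt0// => u.
have [->|u0] := eqVneq u 0; first by rewrite normr0 N0 mulr0.
have u_gt0 : 0 < `|u| by rewrite normr_gt0.
have := cmin (`|u|^-1 *: u); rewrite inE => /(_ (normalize u u0)).
rewrite NZ normfV normr_id ler_pdivlMl// => cu.
by rewrite mulrC ler_pdivlMr.
Qed.

End NormEquivalence.

(** * One mirror descent step *)

Section MirrorStep.
Context {R : realType} {n : nat}.
Context {h : 'rV[R]_n -> \bar R} {dh : 'rV[R]_n -> 'rV[R]_n}.

(** The derivative of the minimized function at [p'] in a feasible direction is
    nonnegative: otherwise a short enough step of length [t] towards [y] would
    change the cost by at most [t * g + e * t * `|y - p'|], which is negative.
    The segment from [p'] to [y] stays in the simplex, hence in the domain to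
    which the one-sided gradient refers. *)
Lemma mirror_step_variational (c : R) (q p p' : 'rV[R]_n) :
  @simplex R n `<=` edom h -> has_gradient h p' (dh p') ->
  argmin (@simplex R n) (fun x => c * dotp q x + bregman h dh x p) p' ->
  forall y, simplex y -> 0 <= dotp (c *: q + (dh p' - dh p)) (y - p').
Proof.
move=> simh grad [sp' minp'] y sy.
set g := dotp _ _; rewrite leNgt; apply/negP => g_lt0.
have [e e0 eg] : exists2 e : R, 0 < e & e * `|y - p'| < - g.
  have B0 : 0 < `|y - p'| + 1 by rewrite ltr_wpDl.
  exists (- g / (`|y - p'| + 1)); first by rewrite divr_gt0// oppr_gt0.
  by rewrite mulrAC ltr_pdivrMr// ltr_pM2l ?oppr_gt0// ltrDl.
have /eqoP/(_ e e0) := grad.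
rewrite /= near_withinE => /nbhs_ballP[d /= d0 dP].
pose t := Num.min 1 (d / 2 / (`|y - p'| + 1)).
have B0 : 0 < `|y - p'| + 1 by rewrite ltr_wpDl.
have t0 : 0 < t by rewrite lt_min ltr01/= !divr_gt0.
have t1 : t <= 1 by rewrite ge_min lexx.
have td : t * `|y - p'| < d.
  have : t <= d / 2 / (`|y - p'| + 1) by rewrite ge_min lexx orbT.
  rewrite ler_pdivlMr// => h1.
  apply: (@lt_le_trans _ _ (d / 2 + d / 2)); last lra.
  by apply: le_lt_trans (_ : t * (`|y - p'| + 1) < _); nra.
set x := p' + t *: (y - p').
have sx : simplex x by apply: simplex_segment; rewrite ?(ltW t0).
have xp' : x - p' = t *: (y - p') by rewrite /x addrC addKr.
have : ball p' d x.
  by rewrite -ball_normE /ball_/= distrC xp' normrZ gtr0_norm.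
move=> /dP /(_ (simh _ sx)); rewrite xp' dotpZr normrZ (gtr0_norm t0).
move=> /(le_trans (ler_norm _)) gradx.
have := minp' _ sx; rewrite /bregman.
rewrite !dotpBr /x !dotpDr !dotpZr -/x => min_x.
have : t * g + e * (t * `|y - p'|) < 0 by nra.
apply/negP; rewrite -leNgt; move: gradx min_x.
rewrite /g dotpDl dotpBl dotpZl !dotpBr; lra.
Qed.

(** Staying at [p] is feasible, so the variational inequality bounds the
    symmetrized divergence of [p] and [p'] by the decrease of the linear cost,
    and cocoercivity bounds it from below. *)
Lemma mirror_step_descent (N : 'rV[R]_n -> R) (L c : R) (q p p' : 'rV[R]_n) :
  @simplex R n `<=` edom h -> has_gradient h p' (dh p') -> 0 < L ->
  cocoercive_on (@simplex R n) N L dh -> simplex p ->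
  argmin (@simplex R n) (fun x => c * dotp q x + bregman h dh x p) p' ->
  N (dh p' - dh p) ^+ 2 <= L * (c * (dotp q p - dotp q p')).
Proof.
move=> simh grad L0 coco sp min_p'.
have := mirror_step_variational c q p p' simh grad min_p' p sp.
have := coco _ _ min_p'.1 sp.
rewrite -ler_pdivrMl// => coc var; apply: le_trans coc _.
rewrite -subr_ge0; apply: le_trans var _.
by rewrite (dotpDl _ (c *: q)) dotpZl !dotpBr; lra.
Qed.

End MirrorStep.

(** * Discounted Markov chains *)

Section DiscountedChain.
Context {R : realType} {n : nat}.

(** Minimum principle: at a minimizer [j] of [w] the average [(P *m w) j] is at
    least [w j], so that [c * w j <= w j], which forces [0 <= w j] as
    [c < 1]. *)
Lemma discounted_superharmonic_ge0 (P : 'M[R]_n) (c : R) (w : 'cV[R]_n) :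
  (forall i j, 0 <= P i j) -> (forall i, \sum_j P i j = 1) -> 0 <= c < 1 ->
  (forall i, c * (P *m w) i 0 <= w i 0) -> forall i, 0 <= w i 0.
Proof.
move=> P0 P1 /andP[c0 c1] sup i.
have [j _ minj] := @arg_minP _ R _ i xpredT (fun l => w l 0) isT.
apply: le_trans (minj i isT).
have : w j 0 <= (P *m w) j 0.
  rewrite -[leLHS]mul1r -(P1 j) mulr_suml mxE.
  by apply: ler_sum => l _; rewrite ler_wpM2l// minj.
have := sup j; nra.
Qed.

(** A kernel vector vanishes, since the minimum principle applies both to it and
    to its opposite. *)
Lemma discounted_unitmx (P : 'M[R]_n) (c : R) :
  (forall i j, 0 <= P i j) -> (forall i, \sum_j P i j = 1) -> 0 <= c < 1 ->
  1%:M - c *: P \in unitmx.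
Proof.
move=> P0 P1 c01; rewrite -unitmx_tr -row_free_unit; apply: inj_row_free => v.
move/(congr1 trmx); rewrite trmx_mul trmxK trmx0 mulmxBl mul1mx -scalemxAl.
move/eqP; rewrite subr_eq0 => /eqP vE.
have harm_ge0 (u : 'cV[R]_n) : u = c *: (P *m u) -> forall i, 0 <= u i 0.
  move=> uE; apply: (discounted_superharmonic_ge0 P c) => // i.
  by rewrite [leRHS](congr1 (fun x : 'cV_n => x i 0) uE) [leRHS]mxE.
apply/rowP => i; apply/eqP; rewrite mxE eq_le.
have := harm_ge0 _ vE i; rewrite mxE => ->.
have := harm_ge0 (- v^T) _ i; rewrite !mxE oppr_ge0 => ->//.
by rewrite mulmxN scalerN -vE.
Qed.

End DiscountedChain.

(** * Policy evaluation, policy improvement and optimality *)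

Section Bellman.
Context {R : realType} {S A : nat} {M : mdp R S A}.
Implicit Types (pi : 'M[R]_(S, A)) (v w : 'cV[R]_S).

(** The Bellman operator of [pi], written through Q-values because these are
    what a mirror descent step minimizes over. *)
Definition bellman pi v : 'cV[R]_S :=
  \col_s dotp (row s (qvalue_of M v)) (row s pi).

Lemma bellmanE pi v :
  bellman pi v = cost_pi M pi + discount M *: (trans_pi M pi *m v).
Proof.
apply/matrixP => s j; rewrite {j}ord1 !mxE /dotp.
under eq_bigr do rewrite !mxE mulrDl.
rewrite big_split/=; congr +%R.
transitivity (discount M *
    \sum_a \sum_s' pi s a * trans M s a s' * v s' 0).
  rewrite mulr_sumr; apply: eq_bigr => a _.
  rewrite -mulrA; congr *%R; rewrite mulr_suml; apply: eq_bigr => s' _; ring.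
congr *%R; rewrite exchange_big; apply: eq_bigr => s' _.
by rewrite !mxE mulr_suml.
Qed.

Lemma qvalue_ofB v w s a : qvalue_of M v s a - qvalue_of M w s a =
  discount M * \sum_(s' < S) trans M s a s' * (v s' 0 - w s' 0).
Proof.
rewrite !mxE; under [in RHS]eq_bigr do rewrite mulrBr.
by rewrite sumrB; ring.
Qed.

Lemma qvalue_of_le v w : (forall s, v s 0 <= w s 0) ->
  forall s a, qvalue_of M v s a <= qvalue_of M w s a.
Proof.
move=> vw s a; rewrite -subr_ge0 qvalue_ofB.
have /andP[c0 _] := discount_itv M.
rewrite mulr_ge0// sumr_ge0// => s' _.
by rewrite mulr_ge0 ?trans_ge0// subr_ge0.
Qed.

Lemma bellman_le pi v w : policies pi -> (forall s, v s 0 <= w s 0) ->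
  forall s, bellman pi v s 0 <= bellman pi w s 0.
Proof.
move=> ppi vw s; rewrite !mxE; apply: ler_sum => a _; rewrite ler_wpM2r//.
  exact: (ppi s).1.
by rewrite mxE [leRHS]mxE; exact: qvalue_of_le.
Qed.

Lemma trans_pi_ge0 pi : policies pi -> forall s s', 0 <= trans_pi M pi s s'.
Proof.
move=> ppi s s'; rewrite mxE sumr_ge0// => a _; rewrite mulr_ge0 ?trans_ge0//.
by have := (ppi s).1 a; rewrite mxE.
Qed.

Lemma trans_pi_sum1 pi : policies pi -> forall s, \sum_s' trans_pi M pi s s' = 1.
Proof.
move=> ppi s; under eq_bigr do rewrite mxE.
rewrite exchange_big/= -(ppi s).2; apply: eq_bigr => a _.
by rewrite -mulr_sumr trans_sum1 mulr1 mxE.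
Qed.

Lemma value_bellman pi : policies pi -> bellman pi (value M pi) = value M pi.
Proof.
move=> ppi; apply/esym/eqP; rewrite bellmanE -subr_eq; apply/eqP.
have Vinv := discounted_unitmx (trans_pi M pi) (discount M)
  (trans_pi_ge0 pi ppi) (trans_pi_sum1 pi ppi) (discount_itv M).
by rewrite -[RHS](mulKVmx Vinv) mulmxBl mul1mx scalemxAl.
Qed.

(** The affine parts cancel in the difference of two images of the Bellman
    operator, which leaves the minimum principle for [w - v]. *)
Lemma bellman_comparison pi v w : policies pi ->
  (forall s, bellman pi w s 0 - bellman pi v s 0 <= w s 0 - v s 0) ->
  forall s, v s 0 <= w s 0.
Proof.
move=> ppi sup s; rewrite -subr_ge0.
have sub i : (w - v) i 0 = w i 0 - v i 0 by rewrite !mxE.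
rewrite -sub; apply: (discounted_superharmonic_ge0 (trans_pi M pi) (discount M)
  (w - v) (trans_pi_ge0 pi ppi) (trans_pi_sum1 pi ppi) (discount_itv M)) => i.
rewrite sub; apply: le_trans (sup i).
rewrite !bellmanE mulmxBr; move: (_ *m w) (_ *m v) => x y.
by rewrite !mxE; lra.
Qed.

Lemma value_le pi v : policies pi ->
  (forall s, bellman pi v s 0 <= v s 0) -> forall s, value M pi s 0 <= v s 0.
Proof.
move=> ppi sup; apply: (bellman_comparison pi) => // s.
by rewrite value_bellman// lerB.
Qed.

Lemma value_ge pi v : policies pi ->
  (forall s, v s 0 <= bellman pi v s 0) -> forall s, v s 0 <= value M pi s 0.
Proof.
move=> ppi sub; apply: (bellman_comparison pi) => // s.
by rewrite value_bellman// lerB.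
Qed.

Lemma value_ge0 pi s : policies pi -> 0 <= value M pi s 0.
Proof.
move=> ppi; have := value_ge pi 0 ppi _ s; rewrite mxE; apply => {}s.
rewrite !mxE sumr_ge0// => a _.
have := (ppi s).1 a; rewrite !mxE big1 => [pi0|s' _]; last by rewrite mxE mulr0.
by rewrite mulr0 addr0 mulr_ge0//; case/andP: (cost_itv M s a).
Qed.

Lemma opt_value_le pi s : policies pi -> opt_value M s 0 <= value M pi s 0.
Proof.
move=> ppi; rewrite mxE; apply: ge_inf; last by exists pi.
by exists 0 => _ [pi' ppi' <-]; exact: value_ge0.
Qed.

Lemma opt_qvalue_le pi s a : policies pi ->
  opt_qvalue M s a <= qvalue M pi s a.
Proof. by move=> ppi; apply: qvalue_of_le => s'; exact: opt_value_le. Qed.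

Lemma value_dotp pi s : policies pi ->
  value M pi s 0 = dotp (row s (qvalue M pi)) (row s pi).
Proof. by move=> ppi; rewrite -[in LHS](value_bellman _ ppi) mxE. Qed.

(** If [pi'] has no larger one-step cost than [pi] in every state, then the value
    of [pi] is a supersolution of the Bellman equation of [pi']. So [pi'] has
    the smaller value, and applying its monotone Bellman operator to both
    values sharpens the bound to the one-step cost. *)
Lemma policy_improvement pi pi' : policies pi -> policies pi' ->
  (forall s, dotp (row s (qvalue M pi)) (row s pi') <= value M pi s 0) ->
  forall s, value M pi' s 0 <= dotp (row s (qvalue M pi)) (row s pi').
Proof.
move=> ppi ppi' imp s.
have le_pi : forall s, value M pi' s 0 <= value M pi s 0.
  by apply: value_le => // s'; rewrite mxE imp.
by rewrite -(value_bellman _ ppi') (le_trans (bellman_le _ _ _ ppi' le_pi s))// mxE.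
Qed.

Definition greedy (q : 'M[R]_(S, A)) pi :=
  forall s a, 0 < pi s a -> forall b, q s a <= q s b.

Lemma dotp_greedy_le (q : 'M[R]_(S, A)) pi pi' s : policies pi -> policies pi' ->
  greedy q pi -> dotp (row s q) (row s pi) <= dotp (row s q) (row s pi').
Proof.
move=> ppi ppi' gpi.
have [[p0 p1] [p0' p1']] := (ppi s, ppi' s).
have [a pa] : exists a, 0 < pi s a.
  apply/not_existsP => pi0.
  suff : \sum_a (row s pi) 0 a <= 0 by rewrite p1 leNgt ltr01.
  by apply: sumr_le0 => a _; rewrite mxE leNgt; apply/negP.
apply: (@le_trans _ _ (q s a)).
  rewrite -[leRHS]mulr1 -p1 mulr_sumr; apply: ler_sum => b _.
  have := p0 b; rewrite !mxE le_eqVlt => /orP[/eqP <-|pb].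
    by rewrite !mulr0.
  by rewrite ler_wpM2r ?(ltW pb)// gpi.
rewrite -[leLHS]mulr1 -p1' mulr_sumr; apply: ler_sum => b _.
by rewrite ler_wpM2r ?p0'// mxE gpi.
Qed.

(** For any policy [pi'], one Bellman step from the optimal value costs [pi] at
    most what it costs [pi'], hence at most the value of [pi']. Taking the
    infimum over [pi'], the optimal value is a supersolution of the Bellman
    equation of [pi], so the value of [pi] is at most the optimal one. *)
Lemma greedy_opt_policies pi : policies pi -> greedy (opt_qvalue M) pi ->
  opt_policies M pi.
Proof.
move=> ppi gpi; split=> //.
have opt_super s : bellman pi (opt_value M) s 0 <= opt_value M s 0.
  rewrite [leRHS]mxE; apply: lb_le_inf; first by exists (value M pi s 0), pi.
  move=> _ [pi' ppi' <-]; rewrite -(value_bellman _ ppi').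
  apply: le_trans (bellman_le pi' _ _ ppi' _ s) => [|s'].
    by rewrite !mxE; exact: dotp_greedy_le.
  exact: opt_value_le.
apply/matrixP => s j; rewrite {j}ord1; apply/eqP; rewrite eq_le opt_value_le//.
by rewrite andbT; exact: value_le.
Qed.

End Bellman.

(** * Policy mirror descent *)

Section PolicyMirrorDescent.
Context {R : realType} {S A : nat} {M : mdp R S A}.
Context {h : 'rV[R]_A -> \bar R} {dh : 'rV[R]_A -> 'rV[R]_A}.
Context {N : 'rV[R]_A -> R} {L eta : R} {pol : nat -> 'M[R]_(S, A)}.
Context (simplex_dom : @simplex R A `<=` edom h).
Context (grad : forall p, @simplex R A p -> has_gradient h p (dh p)).
Context (normN : is_norm N) (L_gt0 : 0 < L) (eta_gt0 : 0 < eta).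
Context (coco : cocoercive_on (@simplex R A) N L dh).
Context (pmd : policy_mirror_descent M h dh eta pol).

Lemma pmd_policies k : policies (pol k).
Proof.
by case: k => [|k]; [exact: pmd.1 | move=> s; exact: (pmd.2 k s).1].
Qed.

Let dual (k : nat) (s : 'I_S) := dh (row s (pol k)).

(** The one-step estimate is used twice: its nonnegative left side shows that
    the step is a policy improvement in every state, and this in turn replaces
    the decrease of the linear cost by the decrease of the value. *)
Lemma pmd_gradient_step_le k s :
  N (dual k.+1 s - dual k s) ^+ 2 <=
  L * (eta * (value M (pol k) s 0 - value M (pol k.+1) s 0)).
Proof.
have [ppi ppi'] := (pmd_policies k, pmd_policies k.+1).
have step s' := mirror_step_descent N L eta (row s' (qvalue M (pol k)))
  (row s' (pol k)) (row s' (pol k.+1)) simplex_dom (grad _ (ppi' s')) L_gt0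
  coco (ppi s') (pmd.2 k s').
apply: le_trans (step s) _.
rewrite ler_pM2l// ler_pM2l// -value_dotp// lerB//.
apply: policy_improvement => // s'.
have := le_trans (sqr_ge0 _) (step s').
by rewrite pmulr_rge0// pmulr_rge0// -value_dotp// subr_ge0.
Qed.

Lemma pmd_value_nonincreasing s :
  nonincreasing_seq (fun k => value M (pol k) s 0 : R^o).
Proof.
apply/nonincreasing_seqP => k.
have := le_trans (sqr_ge0 _) (pmd_gradient_step_le k s).
by rewrite pmulr_rge0// pmulr_rge0// subr_ge0.
Qed.

(** The successive decreases of a convergent monotone sequence of values tend to
    [0], and they dominate the squared norms of the gradient steps. *)
Lemma pmd_gradient_step_cvg0 s e : 0 < e ->
  \forall k \near \oo, forall a, `|(dual k.+1 s - dual k s) 0 a| < e.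
Proof.
move=> e_gt0; have [C C_gt0 leN] := is_norm_lb normN.
set V := fun k => value M (pol k) s 0 : R^o.
have cvgV : cvgn V.
  apply: nonincreasing_is_cvgn; first exact: pmd_value_nonincreasing.
  by exists 0 => _ [k _ <-]; apply: value_ge0; exact: pmd_policies.
(* A decrease of the value below [d] makes the norm [N] of the gradient step
   smaller than [e / C], hence its coordinates smaller than [e]. *)
pose d := (e / C) ^+ 2 / (L * eta).
have d_gt0 : 0 < d by rewrite /d !(divr_gt0, mulr_gt0).
have cvgd : (fun k => V k - V k.+1) @ \oo --> (0 : R^o).
  rewrite -(subrr (limn V)); apply: cvgB; first exact: cvgV.
  by rewrite cvg_shiftS.
near=> k => a.
have Vd : V k - V k.+1 < d.
  by near: k; exact: (cvgr_lt _ cvgd).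
have step_lt : N (dual k.+1 s - dual k s) < e / C.
  have [Nge0 _ _ _] := normN.
  rewrite -(@ltr_pXn2r _ 2) ?nnegrE// ?divr_ge0 ?ltW//.
  apply: le_lt_trans (pmd_gradient_step_le k s) _.
  by rewrite mulrA mulrC -ltr_pdivlMr ?mulr_gt0.
rewrite ltr_pdivlMr// mulrC in step_lt.
apply: le_lt_trans step_lt; apply: le_trans (leN _).
rewrite [leRHS]/Num.norm/= mx_normrE; apply/bigmax_geP; right => /=.
by exists (0, a).
Unshelve. all: by end_near. Qed.

(** While an iterate puts mass on the suboptimal action [a], its gradient step
    must favour [b] over [a] by a fixed positive amount, which is impossible
    once the gradient steps are small. *)
Lemma pmd_suboptimal_eventually0 (Ak : nat -> R) s a b :
  (forall k s a, qvalue M (pol k) s a - opt_qvalue M s a <= Ak k) ->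
  Ak @ \oo --> 0 -> opt_qvalue M s b < opt_qvalue M s a ->
  \forall k \near \oo, pol k.+1 s a = 0.
Proof.
move=> QAk Ak0 ltQ; set gap := opt_qvalue M s a - opt_qvalue M s b.
have gap_gt0 : 0 < gap by rewrite subr_gt0.
near=> k.
have Ak_small : Ak k < gap / 2.
  by near: k; apply: (cvgr_lt _ Ak0); rewrite divr_gt0.
(* The variational inequality compares [eta * (gap - Ak k)], which exceeds
   [eta * gap / 2], with a difference of two coordinates of the gradient step;
   this fixes the bound on each of them. *)
have dual_small : forall c, `|(dual k.+1 s - dual k s) 0 c| < eta * gap / 4.
  by near: k; apply: pmd_gradient_step_cvg0; rewrite !divr_gt0 ?mulr_gt0.
have [p0 _] := pmd_policies k.+1 s.
have := p0 a; rewrite le_eqVlt => /orP[/eqP|pa]; first by rewrite mxE.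
have opt := mirror_step_variational eta (row s (qvalue M (pol k))) (row s (pol k))
  (row s (pol k.+1)) simplex_dom (grad _ (pmd_policies k.+1 s)) (pmd.2 k s).
have := simplex_active_min _ _ a (pmd_policies k.+1 s) opt pa b.
have /ltr_normlP[Da _] := dual_small a; have /ltr_normlP[_ Db] := dual_small b.
rewrite mxE [leRHS]mxE -/(dual k s) -/(dual k.+1 s).
rewrite [X in X + _ <= _]mxE [X in _ <= X + _]mxE.
rewrite [row _ _ _ a]mxE [row _ _ _ b]mxE => min_ab.
have : - (eta * (gap / 2)) < eta * (qvalue M (pol k) s b - qvalue M (pol k) s a).
  by lra.
rewrite -mulrN ltr_pM2l//.
have := QAk k s b; have := opt_qvalue_le (M := M) _ s a (pmd_policies k).
rewrite /gap in Ak_small *; lra.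
Unshelve. all: by end_near. Qed.

End PolicyMirrorDescent.

Theorem theorem4p5 (R : realType) (S A : nat) (M : mdp R S A)
    (h : 'rV[R]_A -> \bar R) (dh : 'rV[R]_A -> 'rV[R]_A)
    (N : 'rV[R]_A -> R) (L eta : R)
    (pi : nat -> 'M[R]_(S, A)) (Ak : nat -> R) :
  proper_efun h -> convex_efun h -> @simplex R A `<=` edom h ->
  continuously_differentiable_on (@simplex R A) h dh ->
  is_norm N -> 0 < L -> cocoercive_on (@simplex R A) N L dh ->
  0 < eta -> policy_mirror_descent M h dh eta pi ->
  (forall k s a, qvalue M (pi k) s a - opt_qvalue M s a <= Ak k) ->
  nonincreasing_seq Ak -> Ak @ \oo --> 0 ->
  exists K : nat, forall (k : nat) (s : 'I_S), (K <= k)%N ->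
    opt_policies_at M s (row s (pi k.+1)) /\
    value M (pi k.+1) s 0 = opt_value M s 0.
Proof.
move=> _ _ simplex_dom [grad _] normN L_gt0 coco eta_gt0 pmd QAk _ Ak0.
have [K _ supp] : \forall k \near \oo, forall x : 'I_S * 'I_A * 'I_A,
    opt_qvalue M x.1.1 x.2 < opt_qvalue M x.1.1 x.1.2 ->
    pi k.+1 x.1.1 x.1.2 = 0.
  apply: filter_forall => -[[s a] b] /=.
  have [ltQ|_] := boolP (opt_qvalue M s b < _); last exact: nearW.
  have := pmd_suboptimal_eventually0 simplex_dom grad normN L_gt0 eta_gt0 coco
    pmd _ _ _ _ QAk Ak0 ltQ.
  by apply: filterS.
exists K => k s Kk.
have opt : opt_policies M (pi k.+1).
  apply: greedy_opt_policies; first exact: (pmd_policies pmd).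
  move=> s' a pa b; rewrite leNgt; apply/negP => ltQ.
  by move: pa; rewrite (supp k Kk (s', a, b) ltQ) ltxx.
by split; [exists (pi k.+1) | rewrite opt.2].
Qed.
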